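(* Let $V$ be a vector space over a field $\mathbb{F}$, let $n>1$, and let $D:V^n\to\mathbb{F}$ be an $n$-determinant on $V$. Then $D$ is antisymmetric: for all $1\le i<j\le n$ and all $u_1,\ldots,u_n\in V$, interchanging the $i$-th and $j$-th arguments changes the sign of $D$, i.e. $$D(u_1,\ldots,u_j,\ldots,u_i,\ldots,u_n)=-D(u_1,\ldots,u_i,\ldots,u_j,\ldots,u_n).$$
   Context: Given a vector space $V$ over a field $\mathbb{F}$ and an integer $n\ge 1$, an $n$-determinant on $V$ is a function $D:V^n\to\mathbb{F}$ that is not identically zero, such that for all $v_1,\ldots,v_n,b\in V$ one has $$D(v_1,\ldots,v_n)\cdot b=\sum_{k=1}^n D(v_1,\ldots,v_{k-1},b,v_{k+1},\ldots,v_n)\cdot v_k,$$ and such that $V$ is not spanned by any $n-1$ vectors of $V$ (so that $V$ has dimension $n$ over $\mathbb{F}$). No linearity or antisymmetry of $D$ is assumed in this definition. *)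

(* Defs.v *)
From mathcomp Require Import all_boot all_order all_fingroup all_algebra.

Set Implicit Arguments.
Unset Strict Implicit.
Unset Printing Implicit Defensive.

Import GRing.Theory.
Local Open Scope ring_scope.

Section NDeterminant.

Variables (F : fieldType) (V : lmodType F) (n : nat).

Definition replace_arg (v : {ffun 'I_n -> V}) (k : 'I_n) (b : V) :
    {ffun 'I_n -> V} :=
  [ffun i => if i == k then b else v i].

Definition swap_args (u : {ffun 'I_n -> V}) (i j : 'I_n) : {ffun 'I_n -> V} :=
  [ffun k => u (tperm i j k)].

(* V is an arbitrary left module over F, so {vspace V} and its span are not
   available; hence the explicit linear combinations. *)
Definition spans (m : nat) (w : 'I_m -> V) : Prop :=
  forall x : V, exists c : 'I_m -> F, x = \sum_(i < m) c i *: w i.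

Record n_determinant (D : {ffun 'I_n -> V} -> F) : Prop := NDeterminant {
  ndet_gt0 : (0 < n)%N;
  ndet_neq0 : exists v, D v != 0;
  ndet_expand : forall (v : {ffun 'I_n -> V}) (b : V),
    D v *: b = \sum_(k < n) D (replace_arg v k b) *: v k;
  ndet_not_spanned : forall w : 'I_(n - 1) -> V, ~ spans w
}.

End NDeterminant.

(* Main.v *)
Require Import Defs.
From mathcomp Require Import all_boot all_order all_fingroup all_algebra.

Set Implicit Arguments.
Unset Strict Implicit.
Unset Printing Implicit Defensive.

Import GRing.Theory.
Local Open Scope ring_scope.

(** If [D v != 0], then [v] spans [V] by the expansion identity, hence is a
    basis, and comparing coordinates [D] picks up the coefficient of [v k] when
    [v k] is replaced.  A swap of [u i] and [u j] is then a product of the three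
    elementary replacements [u i := u i + u j], [u j := u i], [u i := u j],
    which multiply [D] by [1], [-1] and [1]. *)

(** If some [c k] were nonzero, [v k] could be eliminated, and the remaining [n - 1] vectors would
    already span [V]. *)
Lemma ndet_free (F : fieldType) (V : lmodType F) (n : nat)
    (D : {ffun 'I_n -> V} -> F) (detD : n_determinant D)
    (v : {ffun 'I_n -> V}) (c : 'I_n -> F) :
  D v != 0 -> \sum_(k < n) c k *: v k = 0 -> forall k, c k = 0.
Proof.
case: n D detD v c => [|m] D detD v c Dv0 cv0 k; first by case: k.
apply/eqP; apply: contraT => ck0.
(* [m.+1 - 1] is not convertible to [m], so the bound is generalized to [p] to allow families
   indexed by ['I_m]. *)
have nspan p (w : 'I_p -> V) : p = (m.+1 - 1)%N -> ~ spans w.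
  by move=> Ep; subst p; apply: (ndet_not_spanned detD).
case: (nspan m (fun i => v (lift k i))) => [|x]; first by rewrite subn1.
pose d i := (D v)^-1 * D (replace_arg v i x).
have xE : x = \sum_(i < m.+1) d i *: v i.
  rewrite -[LHS](scalerK Dv0) (ndet_expand detD) scaler_sumr.
  by apply: eq_bigr => i _; rewrite scalerA.
exists (fun i => d (lift k i) - d k / c k * c (lift k i)).
(* Subtracting [d k / c k] times the dependency kills the [k]-th coordinate. *)
have -> : x = \sum_(i < m.+1) (d i - d k / c k * c i) *: v i.
  under eq_bigr do rewrite scalerBl -(scalerA (d k / c k)).
  by rewrite sumrB -scaler_sumr cv0 scaler0 subr0.
by rewrite (bigD1_ord k) //= divfK // subrr scale0r add0r.
Qed.

(** With [b] the given combination, [D v *: b] expands along [v] both by the determinant identity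
    and by the [c i]; freeness of [v] equates the coefficients. *)
Lemma ndet_replace_sum (F : fieldType) (V : lmodType F) (n : nat)
    (D : {ffun 'I_n -> V} -> F) (detD : n_determinant D)
    (v : {ffun 'I_n -> V}) (c : 'I_n -> F) (k : 'I_n) :
  D v != 0 -> D (replace_arg v k (\sum_(i < n) c i *: v i)) = c k * D v.
Proof.
move=> Dv0; set b := \sum_(i < n) _; apply/eqP; rewrite -subr_eq0; apply/eqP.
apply: (ndet_free (c := fun i => D (replace_arg v i b) - c i * D v) detD Dv0).
under eq_bigr do rewrite scalerBl mulrC -scalerA.
by rewrite sumrB -(ndet_expand detD) -scaler_sumr subrr.
Qed.

Lemma ndet_replace2 (F : fieldType) (V : lmodType F) (n : nat)
    (D : {ffun 'I_n -> V} -> F) (detD : n_determinant D)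
    (v : {ffun 'I_n -> V}) (k l : 'I_n) (a e : F) :
  l != k -> D v != 0 ->
  D (replace_arg v k (a *: v k + e *: v l)) = a * D v.
Proof.
move=> lk Dv0; pose c i := if i == k then a else if i == l then e else 0.
have -> : a *: v k + e *: v l = \sum_(i < n) c i *: v i.
  rewrite (bigD1 k) // (bigD1 l) //= big1 => [|i /andP[ik il]].
    by rewrite /c (negPf lk) !eqxx addr0.
  by rewrite /c (negPf ik) (negPf il) scale0r.
by rewrite (ndet_replace_sum detD) // /c eqxx.
Qed.

Lemma ndet_swap_neq0 (F : fieldType) (V : lmodType F) (n : nat)
    (D : {ffun 'I_n -> V} -> F) (detD : n_determinant D)
    (i j : 'I_n) (u : {ffun 'I_n -> V}) :
  i != j -> D u != 0 -> D (swap_args u i j) = - D u.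
Proof.
move=> ij Du0; have ji : j != i by rewrite eq_sym.
pose v := replace_arg u i (1 *: u i + 1 *: u j).
have Dv : D v = D u by rewrite (ndet_replace2 detD) // mul1r.
(* Here [v i - v j] is [u i]; the coefficient [-1] of [v j] is the only source of the sign. Each
   stage keeps [D] nonzero, as the next replacement requires. *)
pose w := replace_arg v j (-1 *: v j + 1 *: v i).
have Dw : D w = - D u by rewrite (ndet_replace2 detD) ?Dv // mulN1r.
have -> : swap_args u i j = replace_arg w i (1 *: w i + (-1) *: w j).
  apply/ffunP => k; rewrite !ffunE !eqxx (negPf ij) (negPf ji).
  rewrite !scale1r !scaleN1r addrCA addNr addr0 [u i + u j]addrC addrK.
  by case: tpermP => [->|->|/eqP/negPf-> /eqP/negPf->]; rewrite ?eqxx ?(negPf ji).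
by rewrite (ndet_replace2 detD) ?Dw ?oppr_eq0 // mul1r.
Qed.

Theorem proposition2p7 (F : fieldType) (V : lmodType F) (n : nat)
    (n_gt1 : (1 < n)%N) (D : {ffun 'I_n -> V} -> F) (detD : n_determinant D) :
  forall (i j : 'I_n), (i < j)%N ->
  forall u : {ffun 'I_n -> V}, D (swap_args u i j) = - D u.
Proof.
move=> i j lt_ij u; have ij : i != j by rewrite neq_ltn lt_ij.
have [Du0|] := eqVneq (D u) 0; last exact: (ndet_swap_neq0 detD).
(* When [D u = 0], the nonzero case is applied to the swapped tuple instead, since swapping is an
   involution. *)
have [->|Ds0] := eqVneq (D (swap_args u i j)) 0; first by rewrite Du0 oppr0.
have swapK : swap_args (swap_args u i j) i j = u.
  by apply/ffunP => k; rewrite !ffunE tpermK.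
by rewrite -[in RHS]swapK (ndet_swap_neq0 detD ij Ds0) opprK.
Qed.
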